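(* There is an absolute constant $c>0$ such that the following holds. Let $k$ be a positive integer and let $d \geq 4$ be an integer. Then there exists a set $P$ of points in $\mathbb{R}^d$ such that, letting $\mathcal{R}$ denote the set system induced on $P$ by half-spaces of $\mathbb{R}^d$, we have $$\operatorname{vcdim}\left(\mathcal{R}^{k\cup}\right) \geq c \cdot \operatorname{vcdim}(\mathcal{R}) \cdot k \log k \quad\text{and}\quad \operatorname{vcdim}\left(\mathcal{R}^{k\cup}\right) \geq c\cdot d \cdot k \log k,$$ and likewise $$\operatorname{vcdim}\left(\mathcal{R}^{k\cap}\right) \geq c \cdot \operatorname{vcdim}(\mathcal{R}) \cdot k \log k \quad\text{and}\quad \operatorname{vcdim}\left(\mathcal{R}^{k\cap}\right) \geq c\cdot d \cdot k \log k.$$ (In the paper's notation: $\operatorname{vcdim}(\mathcal{R}^{k\cup}) = \Omega(\operatorname{vcdim}(\mathcal{R})\cdot k\log k) = \Omega(d\cdot k\log k)$, and the same for $\mathcal{R}^{k\cap}$.)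
   Context: A set system $(X,\mathcal{R})$ consists of a set $X$ and a family $\mathcal{R}$ of subsets of $X$. The set system induced on $P \subseteq \mathbb{R}^d$ by half-spaces is $\mathcal{R} = \{P \cap H : H \text{ a (closed or open) half-space of } \mathbb{R}^d\}$. For an integer $k \geq 1$, the $k$-fold union is $\mathcal{R}^{k\cup} = \{R_1 \cup \cdots \cup R_k : R_1,\dots,R_k \in \mathcal{R}\}$ (the $R_i$ need not be distinct), and the $k$-fold intersection is $\mathcal{R}^{k\cap} = \{R_1 \cap \cdots \cap R_k : R_1,\dots,R_k \in \mathcal{R}\}$ (the $R_i$ need not be distinct). For $Y \subseteq X$, $\mathcal{R}$ shatters $Y$ if $\{Y \cap R : R \in \mathcal{R}\}$ is the full power set of $Y$; $\operatorname{vcdim}(\mathcal{R})$ is the largest size of a subset of $X$ shattered by $\mathcal{R}$. Logarithms are base 2. *)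

(* Defs.v *)
From HB Require Import structures.
From mathcomp Require Import all_boot all_order all_algebra.
From mathcomp Require Import Rstruct.
From Stdlib Require Import Reals.

Set Implicit Arguments. Unset Strict Implicit. Unset Printing Implicit Defensive.
Import Order.TTheory GRing.Theory Num.Theory.

Definition shatters {T : eqType} (X : T -> Prop) (F : (T -> Prop) -> Prop)
    (Y : seq T) : Prop :=
  uniq Y /\ (forall y, y \in Y -> X y) /\
  forall Z : T -> Prop, (forall z, Z z -> z \in Y) ->
    exists S, F S /\ forall y, (y \in Y /\ S y) <-> Z y.

Definition is_vcdim {T : eqType} (X : T -> Prop) (F : (T -> Prop) -> Prop)
    (n : nat) : Prop :=
  (exists Y, shatters X F Y /\ size Y = n) /\
  (forall Y, shatters X F Y -> (size Y <= n)%N).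

Definition point (d : nat) := 'rV[R]_d.

Local Open Scope ring_scope.
Definition dotp (d : nat) (a x : point d) : R :=
  \sum_(i < d) a ord0 i * x ord0 i.
Local Close Scope ring_scope.

(* H is a closed or open half-space { x | <a,x> <= b } or { x | <a,x> < b }
   with a <> 0 (the other orientations are obtained by negating a, b). *)
Definition halfspace (d : nat) (H : point d -> Prop) : Prop :=
  exists (a : point d) (b : R), a <> (GRing.zero : point d) /\
    ((forall x, H x <-> Rle (dotp a x) b) \/
     (forall x, H x <-> Rlt (dotp a x) b)).

Definition halfspace_system (d : nat) (P : point d -> Prop)
    : (point d -> Prop) -> Prop :=
  fun S => exists H, halfspace H /\ forall x, S x <-> (P x /\ H x).

(* k-fold unions / intersections (members need not be distinct). *)
Definition kunion {T : Type} (k : nat) (F : (T -> Prop) -> Prop)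
    : (T -> Prop) -> Prop :=
  fun S => exists Rs : 'I_k -> (T -> Prop),
    (forall i, F (Rs i)) /\ forall x, S x <-> exists i, Rs i x.

Definition kinter {T : Type} (k : nat) (F : (T -> Prop) -> Prop)
    : (T -> Prop) -> Prop :=
  fun S => exists Rs : 'I_k -> (T -> Prop),
    (forall i, F (Rs i)) /\ forall x, S x <-> forall i, Rs i x.

Definition log2 (x : R) : R := Rdiv (Rpower.ln x) (Rpower.ln (INR 2)).

(* Main.v *)
(** A family of n 2^(n-1) axis-parallel rectangles is built recursively such
    that each of its subfamilies is exactly the set of rectangles hit by some
    2^n points (these point sets are the binary digital nets; each rectangle is
    an independent switch).  Membership of a point in a rectangle is dominance
    between vectors of Z^4, and dominance in Z^m lifts to incidence of points
    and half-spaces in R^m: a_i <= b_i for all i iff the sum of the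
    B^(a_i - b_i) is at most m, for a large base B.  As the right-hand side m is
    constant, floor(d/4) copies placed in orthogonal coordinate blocks of R^d
    are controlled simultaneously by the same 2^n <= k half-spaces.  Radon's
    argument bounds the VC-dimension of half-spaces by d+1, and complementation
    turns unions into intersections. *)

Require Import Defs.
From Stdlib Require Import Reals.
From HB Require Import structures.
From mathcomp Require Import all_boot all_order all_algebra.
From mathcomp Require Import boolp exp Rstruct Rstruct_topology.
From mathcomp Require Import zify lra.

Set Implicit Arguments. Unset Strict Implicit. Unset Printing Implicit Defensive.
Import Order.TTheory GRing.Theory Num.Theory.

Section Shattering.
Variable T : eqType.
Implicit Types (X : T -> Prop) (F G : (T -> Prop) -> Prop) (Y : seq T).

Lemma shatters_nil X F S : F S -> shatters X F [::].
Proof.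
move=> FS; split=> //; split=> // Z Znil.
by exists S; split=> // y; split=> [[] | /Znil].
Qed.

Lemma shatters_size_le X F Y s :
  (forall x, X x -> x \in s) -> shatters X F Y -> size Y <= size s.
Proof. by move=> Xs [uY [YX _]]; apply: uniq_leq_size => // y /YX /Xs. Qed.

Lemma shatters_sub X F G Y :
  (forall S, F S -> G S) -> shatters X F Y -> shatters X G Y.
Proof.
move=> FG [uY [YX shY]]; split=> //; split=> // Z /shY[S [FS SZ]].
by exists S; split=> //; apply: FG.
Qed.

Lemma shatters_tnth X F Y (s : pred 'I_(size Y)) : shatters X F Y ->
  exists2 S, F S & forall i, S (tnth (in_tuple Y) i) <-> s i.
Proof.
case=> /(tuple_uniqP (in_tuple Y)) injY [_ shY].
pose Z y := exists2 i, y = tnth (in_tuple Y) i & s i.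
have memY i : tnth (in_tuple Y) i \in Y by apply: (mem_tnth i (in_tuple Y)).
have [|S [FS SZ]] := shY Z; first by move=> _ [i -> _].
exists S => // i; split=> [Si|si].
  by have /SZ[j /injY ->] := conj (memY i) Si.
by have /SZ[] : Z (tnth (in_tuple Y) i) by exists i.
Qed.

Lemma shatters_codom (J : finType) (f : J -> T) X F :
  (forall j, X (f j)) ->
  (forall s : pred J, exists2 S, F S & forall j, S (f j) <-> s j) ->
  shatters X F (codom f).
Proof.
move=> Xf Ff; split; last split.
- apply/injectiveP => i j fij; have [S _ Sf] := Ff (pred1 i).
  by have /Sf := eqxx i; rewrite fij => /Sf /eqP.
- by move=> _ /codomP[j ->].
move=> Z Zf; have [S FS Sf] := Ff (fun j => `[< Z (f j) >]).
exists S; split=> // y; split=> [[/codomP[j ->] /Sf /asboolP //]|Zy].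
have fy := Zf _ Zy; split=> //; case/codomP: fy Zy => j -> Zj.
exact/Sf/asboolP.
Qed.

Lemma vcdim_exists X F Y N :
  (forall Y', shatters X F Y' -> size Y' <= N) -> shatters X F Y ->
  exists2 n, is_vcdim X F n & size Y <= n <= N.
Proof.
move=> leN shY.
pose shattered_size n := `[< exists2 Y', shatters X F Y' & size Y' = n >].
have ex : exists n, shattered_size n.
  by exists (size Y); apply/asboolP; exists Y.
have ub n : shattered_size n -> n <= N by move=> /asboolP[Y' /leN ? <-].
have max Y' : shatters X F Y' -> shattered_size (size Y').
  by move=> shY'; apply/asboolP; exists Y'.
case: (ex_maxnP ex ub) => n pn maxn; exists n; last by rewrite maxn ?ub ?max.
case/asboolP: pn => Yn shYn szn.
by split=> [|Y' /max /maxn //]; exists Yn.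
Qed.

Lemma kunion_leq F (k k' : nat) S :
  0 < k <= k' -> kunion k F S -> kunion k' F S.
Proof.
case/andP=> k_gt0 lek [Rs [FRs SRs]].
pose squash (i : 'I_k') : 'I_k := insubd (Ordinal k_gt0) (val i).
exists (Rs \o squash); split=> [i|x]; first exact: FRs.
rewrite SRs; split=> -[i Ri]; last by exists (squash i).
by exists (widen_ord lek i); rewrite /= /squash valKd.
Qed.

Lemma shatters_kinter X F k Y :
  (forall S, F S -> F (fun x => X x /\ ~ S x)) ->
  shatters X (kunion k F) Y -> shatters X (kinter k F) Y.
Proof.
move=> FC [uY [YX shY]]; split=> //; split=> // Z ZY.
have [|S [[Rs [FRs SRs]] SZ]] := shY (fun y => y \in Y /\ ~ Z y).
  by move=> z [].
exists (fun x => forall i, X x /\ ~ Rs i x); split.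
  by exists (fun i x => X x /\ ~ Rs i x); split=> // i; apply: FC.
move=> y; split=> [[yY nRy]|Zy].
  apply: contrapT => nZy; have /SZ[_ /SRs[i Ri]] := conj yY nZy.
  by case: (nRy i).
have yY := ZY _ Zy; split=> // i; split; first exact: YX.
by move=> Ri; have /SZ[] : y \in Y /\ S y by split=> //; apply/SRs; exists i.
Qed.

End Shattering.

Local Open Scope ring_scope.

Section Halfspaces.
Variable d : nat.
Implicit Types (a x : point d) (b : R) (H : point d -> Prop).

Lemma dotpNl a x : dotp (- a) x = - dotp a x.
Proof. by rewrite /dotp -sumrN; apply: eq_bigr => i _; rewrite mxE mulNr. Qed.

Lemma dotp0r a : dotp a 0 = 0.
Proof. by rewrite /dotp big1 // => i _; rewrite mxE mulr0. Qed.

Lemma dotp_sumZr a (I : finType) (u : I -> R) (p : I -> point d) :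
  dotp a (\sum_i u i *: p i) = \sum_i u i * dotp a (p i).
Proof.
rewrite /dotp; under eq_bigr do rewrite summxE mulr_sumr.
rewrite exchange_big; apply: eq_bigr => i _; rewrite mulr_sumr.
by apply: eq_bigr => j _; rewrite mxE mulrCA.
Qed.

Lemma halfspaceP H : halfspace H <-> exists a b, a != 0 /\
  ((forall x, H x <-> dotp a x <= b) \/ (forall x, H x <-> dotp a x < b)).
Proof.
split=> -[a [b [/eqP a_neq0 Hab]]]; exists a, b; split=> //;
  by case: Hab => Hab; [left|right] => x; rewrite Hab ?(rwP RleP) ?(rwP RltP).
Qed.

Lemma halfspaceC H : halfspace H -> halfspace (fun x => ~ H x).
Proof.
move=> /halfspaceP[a [b [a_neq0 Hab]]]; apply/halfspaceP; exists (- a), (- b).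
rewrite oppr_eq0; split=> //; case: Hab => Hab; [right|left] => x.
  by rewrite Hab dotpNl ltrN2 ltNge; split=> /negP.
by rewrite Hab dotpNl lerN2 leNgt; split=> /negP.
Qed.

Lemma halfspace_systemC (P : point d -> Prop) S :
  halfspace_system P S -> halfspace_system P (fun x => P x /\ ~ S x).
Proof.
case=> H [hH SH]; exists (fun x => ~ H x); split; first exact: halfspaceC.
move=> x; rewrite SH.
by split=> -[Px nHx]; split=> //; [move=> Hx; exact: nHx | case].
Qed.

End Halfspaces.

Lemma affine_dependence (F : fieldType) (d n : nat) (p : 'I_n -> 'rV[F]_d) :
  (d.+1 < n)%N ->
  exists u : 'rV[F]_n,
    [/\ u != 0, \sum_i u 0 i = 0 & \sum_i u 0 i *: p i = 0].
Proof.
move=> ltdn; pose M : 'M_(n, d + 1) := row_mx (\matrix_i p i) (const_mx 1).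
have : kermx M != 0.
  by rewrite kermx_eq0 /row_free neq_ltn; have := rank_leq_col M; lia.
case/rowV0Pn=> u /sub_kermxP + u_neq0; rewrite mul_mx_row -row_mx0.
case/eq_row_mx=> up u1; exists u; split=> //.
  have /matrixP/(_ 0 0) := u1; rewrite !mxE => sum_u1.
  by rewrite -[RHS]sum_u1; apply: eq_bigr => i _; rewrite mxE mulr1.
by rewrite -[RHS]up mulmx_sum_row; apply: eq_bigr => i _; rewrite rowK.
Qed.

Lemma sumr_eq0_gt0 (R : realDomainType) (I : finType) (u : I -> R) i0 :
  \sum_i u i = 0 -> u i0 != 0 -> exists i, 0 < u i.
Proof.
move=> sum0 ui0; apply/existsP; apply: contraNT ui0.
rewrite negb_exists => /forallP u_le0.
have {}u_le0 i : true -> 0 <= - u i by rewrite oppr_ge0 leNgt u_le0.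
by rewrite -oppr_eq0 (psumr_eq0P u_le0) // sumrN sum0 oppr0.
Qed.

(* Radon's argument: if H contained exactly the points with positive
   coefficient, pairing the dependence with the functional that defines H would
   give a vanishing sum of nonpositive terms, so that points with coefficients
   of both signs lie on the boundary of H. *)
Lemma halfspace_not_positive_part (d n : nat) (p : 'I_n -> point d)
    (u : 'rV[R]_n) (H : point d -> Prop) :
  u != 0 -> \sum_i u 0 i = 0 -> \sum_i u 0 i *: p i = 0 ->
  halfspace H -> ~ (forall i, H (p i) <-> 0 < u 0 i).
Proof.
move=> u_neq0 sum_u sum_up /halfspaceP[a [b [_ Hab]]] Hu.
pose w i := dotp a (p i) - b.
have sum_uw : \sum_i - (u 0 i * w i) = 0.
  rewrite sumrN /w; under eq_bigr do rewrite mulrBr.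
  by rewrite sumrB -dotp_sumZr sum_up dotp0r -mulr_suml sum_u mul0r subr0 oppr0.
have [i0 ui0] : exists i, u 0 i != 0 by apply/rV0Pn.
have [i u_gt0] := sumr_eq0_gt0 sum_u ui0.
have [j u_lt0] : exists j, u 0 j < 0.
  have sum_Nu : \sum_i - u 0 i = 0 by rewrite sumrN sum_u oppr0.
  have Nui0 : - u 0 i0 != 0 by rewrite oppr_eq0.
  by have [j] := sumr_eq0_gt0 sum_Nu Nui0; rewrite oppr_gt0; exists j.
have boundary : (forall l, u 0 l * w l <= 0) -> forall l, u 0 l != 0 -> w l = 0.
  move=> uw_le0 l ul_neq0; apply/eqP.
  have Nuw_ge0 m : true -> 0 <= - (u 0 m * w m) by rewrite oppr_ge0.
  have /eqP : - (u 0 l * w l) = 0 by apply: psumr_eq0P Nuw_ge0 sum_uw _ _.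
  by rewrite oppr_eq0 mulf_eq0 (negPf ul_neq0).
case: Hab => Hab.
- have wu l : (w l <= 0) = (0 < u 0 l).
    by rewrite subr_le0; apply/idP/idP => [/Hab/Hu|/Hu/Hab].
  have uw_le0 l : u 0 l * w l <= 0 by have := wu l; nra.
  have wj : w j = 0 by apply: boundary; rewrite ?lt_eqF.
  by have := wu j; rewrite wj lexx; lra.
- have wu l : (w l < 0) = (0 < u 0 l).
    by rewrite subr_lt0; apply/idP/idP => [/Hab/Hu|/Hu/Hab].
  have uw_le0 l : u 0 l * w l <= 0 by have := wu l; nra.
  have wi : w i = 0 by apply: boundary; rewrite ?gt_eqF.
  by have := wu i; rewrite wi ltxx u_gt0.
Qed.

Lemma shatters_halfspace_size_le (d : nat) (P : point d -> Prop)
    (Y : seq (point d)) :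
  shatters P (halfspace_system P) Y -> (size Y <= d.+1)%N.
Proof.
move=> shY; rewrite leqNgt; apply/negP.
case/(affine_dependence (tnth (in_tuple Y))) => u [u_neq0 sum_u sum_up].
have [S [H [hH SH]] Su] := shatters_tnth (fun i => 0 < u 0 i) shY.
apply: halfspace_not_positive_part u_neq0 sum_u sum_up hH _ => i.
rewrite -Su SH; split=> [Hi|[]//]; split=> //.
by case: shY => _ [YP _]; apply/YP/(mem_tnth i (in_tuple Y)).
Qed.

Lemma vcdim_halfspace_exists (d : nat) (P : point d -> Prop) : (0 < d)%N ->
  exists2 n, is_vcdim P (halfspace_system P) n & (n <= d.+1)%N.
Proof.
move=> d_gt0; pose H (x : point d) := dotp (const_mx 1) x <= 0.
have hH : halfspace H.
  apply/halfspaceP; exists (const_mx 1), 0; split; last by left.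
  by apply/rV0Pn; exists (Ordinal d_gt0); rewrite mxE oner_eq0.
have nil : shatters P (halfspace_system P) [::].
  by apply: (@shatters_nil _ _ _ (fun x => P x /\ H x)); exists H.
have size_le := @shatters_halfspace_size_le d P.
by have [n vcn /andP[_ n_le]] := vcdim_exists size_le nil; exists n.
Qed.

Lemma sumr_le_card (R : realDomainType) (I : finType) (x : I -> R) :
  (forall i, 0 <= x i) -> (forall i, x i <= 1 \/ #|I|%:R < x i) ->
  (\sum_i x i <= #|I|%:R) = [forall i, x i <= 1].
Proof.
move=> x_ge0 x_gap; apply/idP/forallP => [sum_le i | x_le1].
  case: (x_gap i) => //; rewrite ltNge (le_trans _ sum_le) //.
  by rewrite (bigD1 i) //= lerDl sumr_ge0.
by rewrite -sumr_const; apply: ler_sum.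
Qed.

Lemma exprz_le1 (R : realFieldType) (b : R) (z : int) :
  1 < b -> (b ^ z <= 1) = (z <= 0).
Proof. by move=> b_gt1; rewrite -(expr0z b) ler_eXz2l. Qed.

Lemma exprz_le1_or_ge (R : realFieldType) (b : R) (z : int) :
  1 < b -> b ^ z <= 1 \/ b <= b ^ z.
Proof.
move=> b_gt1; rewrite exprz_le1 // -{1}(expr1z b) ler_eXz2l //.
by have [|] := leP z 0; [left|right; lia].
Qed.

Section CoordinateEmbedding.
Variables (I : finType) (d : nat).
Hypothesis card_le_dim : (#|I| <= d)%N.

Definition coord (i : I) : 'I_d := widen_ord card_le_dim (enum_rank i).

Definition coord_vec (x : I -> R) : point d :=
  \row_k \sum_(i | coord i == k) x i.

Lemma coord_inj : injective coord.
Proof. by move=> i j /(congr1 val) /= /ord_inj /enum_rank_inj. Qed.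

Lemma coord_vecE x i : coord_vec x 0 (coord i) = x i.
Proof. by rewrite mxE (big_pred1 i) // => j; rewrite (inj_eq coord_inj). Qed.

Lemma dotp_coord_vec (a x : I -> R) :
  dotp (coord_vec a) (coord_vec x) = \sum_i a i * x i.
Proof.
rewrite [RHS](partition_big coord predT) //=; apply: eq_bigr => k _.
rewrite [coord_vec a _ _]mxE mulr_suml; apply: eq_bigr => i /eqP <-.
by rewrite coord_vecE.
Qed.

End CoordinateEmbedding.

Definition dominates (I : finType) (b a : I -> int) : bool :=
  [forall i, a i <= b i].

Section BlockEmbedding.
Variables (M K : finType) (d : nat).
Hypothesis card_le_dim : (#|{: M * K}| <= d)%N.

Let base : R := #|M|.+2%:R.

Definition block_point (a : M -> int) (k : K) : point d :=
  coord_vec card_le_dim (fun ij => if ij.2 == k then base ^ a ij.1 else 0).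

Definition block_normal (b : K -> M -> int) : point d :=
  coord_vec card_le_dim (fun ij => base ^ (- b ij.2 ij.1)).

(* Term i of the sum is base ^ (a i - b k i): at most 1 if a i <= b k i, and at
   least base > #|M| otherwise. *)
Lemma block_incidence a b k :
  (dotp (block_normal b) (block_point a k) <= #|M|%:R) = dominates (b k) a.
Proof.
have -> : dotp (block_normal b) (block_point a k) = \sum_i base ^ (a i - b k i).
  rewrite dotp_coord_vec.
  rewrite -(pair_bigA _ (fun i j =>
    base ^ (- b j i) * if j == k then base ^ a i else 0)).
  apply: eq_bigr => i _; rewrite (bigD1 k) //= eqxx big1 ?addr0.
    by rewrite -expfzDr ?pnatr_eq0 // addrC.
  by move=> j /negPf ->; rewrite mulr0.
have base_gt1 : 1 < base by rewrite ltr1n ltnS.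
rewrite sumr_le_card; last 2 first.
- by move=> i; rewrite exprz_ge0 // ler0n.
- move=> i; have [le1|ge_base] := exprz_le1_or_ge (a i - b k i) base_gt1.
    by left.
  by right; apply: lt_le_trans ge_base; rewrite ltr_nat.
by apply: eq_forallb => i; rewrite exprz_le1 // subr_le0.
Qed.

Lemma block_normal_neq0 b (ij : M * K) : block_normal b != 0.
Proof.
apply/rV0Pn; exists (coord card_le_dim ij).
by rewrite coord_vecE expfz_neq0 // pnatr_eq0.
Qed.

End BlockEmbedding.

Definition kunion_self_shattered (d k : nat) (Y : seq (point d)) : Prop :=
  let P x := x \in Y in shatters P (kunion k (halfspace_system P)) Y.

(* The half-spaces that realise the orthants with a given index all have the
   right-hand side #|M|, so one half-space serves all the blocks at once. *)
Lemma kunion_self_shattered_blocks (J M K : finType) (d N : nat)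
    (a : J -> M -> int) :
  (0 < #|M| * #|K|)%N -> (#|M| * #|K| <= d)%N ->
  (forall s : pred J, exists b : 'I_N -> M -> int,
     forall j, s j = [exists h, dominates (b h) (a j)]) ->
  exists2 Y : seq (point d),
    kunion_self_shattered N Y & size Y = (#|J| * #|K|)%N.
Proof.
rewrite -card_prod => /card_gt0P[ij _] card_le shJ.
pose f (jk : J * K) : point d := block_point card_le (a jk.1) jk.2.
exists (codom f); last by rewrite size_codom card_prod.
apply: shatters_codom => [jk|s]; first exact: codom_f.
have /choice[b sb] k := shJ (fun j => s (j, k)).
pose normal h := block_normal card_le (b^~ h).
pose H h (x : point d) : Prop := dotp (normal h) x <= #|M|%:R.
pose Rs h x := x \in codom f /\ H h x.
exists (fun x => exists h, Rs h x) => [|[j k]].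
  exists Rs; split=> // h; exists (H h); split=> //; apply/halfspaceP.
  exists (normal h), #|M|%:R; split; last by left.
  exact: block_normal_neq0.
rewrite /Rs /H sb; split=> [[h [_]]|/existsP[h]].
  by rewrite block_incidence => ?; apply/existsP; exists h.
by exists h; split; [exact: codom_f | rewrite block_incidence].
Qed.

Local Close Scope ring_scope.

Record rect := Rect { xlo : nat; xhi : nat; ylo : nat; yhi : nat }.

Definition in_rect (r : rect) (x y : nat) : bool :=
  (xlo r <= x < xhi r) && (ylo r <= y < yhi r).

Section RectangleDoubling.
Variable N : nat.
Implicit Types (r : rect) (q : nat -> nat) (u : nat -> bool).

Definition hit (n : nat) q r : Prop := exists2 y, y < n & in_rect r (q y) y.

Definition left_copy r : rect := Rect (xlo r) (xhi r) (ylo r).*2 (yhi r).*2.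

Definition right_copy r : rect :=
  Rect (N + xlo r) (N + xhi r) (ylo r).*2 (yhi r).*2.

Definition new_rect (y : nat) : rect := Rect 0 N y.*2.+1 y.*2.+2.

(* Rows 2y and 2y+1 carry the points of row y of the left half x < N and of the
   right half.  Their order, chosen by u y, is invisible to the stretched copies
   and decides whether new_rect y is hit. *)
Definition interleave u (ql qr : nat -> nat) (y : nat) : nat :=
  if odd y == u y./2 then ql y./2 else N + qr y./2.

Lemma in_left_copy r x y (b : bool) :
  in_rect (left_copy r) x (b + y.*2) = in_rect r x y.
Proof. by rewrite /in_rect /=; congr (_ && _); case: b; lia. Qed.

Lemma in_right_copy r x y (b : bool) :
  in_rect (right_copy r) (N + x) (b + y.*2) = in_rect r x y.
Proof.
by rewrite /in_rect /= leq_add2l ltn_add2l; congr (_ && _); case: b; lia.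
Qed.

Lemma in_new_rect z x y (b : bool) :
  in_rect (new_rect z) x (b + y.*2) = [&& x < N, b & y == z].
Proof. by rewrite /in_rect /=; case: b; lia. Qed.

Section Interleave.
Variables (u : nat -> bool) (ql qr : nat -> nat).
Hypothesis ql_lt : forall y, y < N -> ql y < N.
Hypothesis qr_lt : forall y, y < N -> qr y < N.

Lemma interleave_lt y : y < N.*2 -> interleave u ql qr y < N.*2.
Proof.
move=> lty; have y2 : y./2 < N by lia.
by rewrite /interleave; case: ifP => _; have := ql_lt y2; have := qr_lt y2; lia.
Qed.

Lemma hit_interleave r : hit N.*2 (interleave u ql qr) r <->
  exists2 y, y < N & in_rect r (ql y) (u y + y.*2) ||
                     in_rect r (N + qr y) (~~ u y + y.*2).
Proof.
have interleaveE (b : bool) y :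
    interleave u ql qr (b + y.*2) = if b == u y then ql y else N + qr y.
  by rewrite /interleave half_bit_double oddD odd_double addbF oddb.
split=> -[y].
  rewrite -(odd_double_half y); move: (odd y) y./2 => b z ltbzN.
  rewrite interleaveE => rz; exists z; first by lia.
  by case: b (u z) rz {ltbzN} => [] [] /= ->; rewrite ?orbT.
move=> ltyN /orP[]ry; [exists (u y + y.*2) | exists (~~ u y + y.*2)];
  rewrite ?interleaveE ?eqxx //; try by case: (u y); lia.
by move: ry; case: (u y).
Qed.

Lemma hit_left_copy r : xhi r <= N ->
  hit N.*2 (interleave u ql qr) (left_copy r) <-> hit N ql r.
Proof.
move=> rN; rewrite hit_interleave; split=> -[y ltyN ry]; exists y => //.
  by case/orP: ry; rewrite in_left_copy //; rewrite /in_rect; lia.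
by rewrite in_left_copy ry.
Qed.

Lemma hit_right_copy r :
  hit N.*2 (interleave u ql qr) (right_copy r) <-> hit N qr r.
Proof.
rewrite hit_interleave; split=> -[y ltyN ry]; exists y => //.
  case/orP: ry; last by rewrite in_right_copy.
  by have := ql_lt ltyN; rewrite /in_rect /=; lia.
by rewrite in_right_copy ry orbT.
Qed.

Lemma hit_new_rect y : y < N ->
  hit N.*2 (interleave u ql qr) (new_rect y) <-> u y.
Proof.
move=> ltyN; rewrite hit_interleave; split=> [[z _]|uy].
  rewrite !in_new_rect (ltnNge (N + _)) leq_addr /= orbF.
  by case/and3P=> _ uz /eqP <-.
by exists y; rewrite // in_new_rect ql_lt // uy eqxx.
Qed.

End Interleave.

Definition independent_switches (n : nat) (J : Type) (r : J -> rect) : Prop :=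
  (forall j, xhi (r j) <= n) /\
  forall s : pred J, exists2 q : nat -> nat,
    (forall y, y < n -> q y < n) & forall j, s j <-> hit n q (r j).

Definition double_rects (J : Type) (r : J -> rect) (j : J + J + 'I_N) : rect :=
  match j with
  | inl (inl j) => left_copy (r j)
  | inl (inr j) => right_copy (r j)
  | inr y => new_rect y
  end.

Lemma independent_switches_double (J : Type) (r : J -> rect) :
  independent_switches N r -> independent_switches N.*2 (double_rects r).
Proof.
case=> rN switch_r; split=> [[[j|j]|y] /=|s].
- by have := rN j; lia.
- by have := rN j; lia.
- by lia.
have [ql ql_lt hl] := switch_r (s \o inl \o inl).
have [qr qr_lt hr] := switch_r (s \o inl \o inr).
pose u y := oapp (s \o inr) false (insub y).
exists (interleave u ql qr) => [y|[[j|j]|y] /=]; first exact: interleave_lt.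
- by rewrite hit_left_copy //; apply: hl.
- by rewrite hit_right_copy //; apply: hr.
- by rewrite hit_new_rect // /u valK.
Qed.

End RectangleDoubling.

Fixpoint switch_index (n : nat) : finType :=
  if n is m.+1 then (switch_index m + switch_index m + 'I_(2 ^ m))%type
  else void.

Fixpoint switch_rect (n : nat) : switch_index n -> rect :=
  if n is m.+1 then @double_rects (2 ^ m) _ (@switch_rect m)
  else fun j : void => match j with end.

Lemma card_switch_index n : #|switch_index n| * 2 = n * 2 ^ n.
Proof.
elim: n => [|n IHn]; first by rewrite card_void.
by rewrite !card_sum card_ord !mulnDl IHn expnS; nia.
Qed.

Lemma independent_switch_rect n : independent_switches (2 ^ n) (@switch_rect n).
Proof.
elim: n => [|n IHn]; first by split=> [[]|s]; exists id.
by rewrite expnS mul2n; apply: independent_switches_double.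
Qed.

Local Open Scope ring_scope.

Definition rect_corner (r : rect) (i : 'I_4) : int :=
  nth 0 [:: xlo r : int; - (xhi r : int); ylo r : int; - (yhi r : int)] i.

Definition point_corner (x y : nat) (i : 'I_4) : int :=
  nth 0 [:: x : int; - (x.+1 : int); y : int; - (y.+1 : int)] i.

Lemma dominates_corner r x y :
  dominates (point_corner x y) (rect_corner r) = in_rect r x y.
Proof.
transitivity (\big[andb/true]_i (rect_corner r i <= point_corner x y i)).
  by rewrite big_andE.
by rewrite !big_ord_recl big_ord0 /rect_corner /point_corner /in_rect /=; lia.
Qed.

Lemma switch_rect_dominates n (s : pred (switch_index n)) :
  exists b : 'I_(2 ^ n) -> 'I_4 -> int,
    forall j, s j = [exists h, dominates (b h) (rect_corner (switch_rect j))].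
Proof.
have [_ /(_ s)[q _ sq]] := independent_switch_rect n.
exists (fun y => point_corner (q y) y) => j.
apply/idP/existsP => [/sq[y lty ry]|[y]].
  by exists (Ordinal lty); rewrite dominates_corner.
by rewrite dominates_corner => ry; apply/sq; exists y.
Qed.

Lemma kunion_self_shattered_pow2 (n d : nat) : (4 <= d)%N ->
  exists2 Y : seq (point d),
    kunion_self_shattered (2 ^ n) Y & (size Y * 2 = d %/ 4 * (n * 2 ^ n))%N.
Proof.
move=> d_ge4.
have [||Y shY sizeY] := kunion_self_shattered_blocks (K := 'I_(d %/ 4))
  (d := d) _ _ (@switch_rect_dominates n); [by rewrite !card_ord; lia..|].
by exists Y; rewrite // sizeY card_ord mulnAC card_switch_index mulnC.
Qed.

Lemma log2E (x : R) : log2 x = exp.ln x / exp.ln (2%:R : R).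
Proof. by rewrite /log2 !RlnE INRE. Qed.

Lemma log2_ge0 (x : R) : 1 <= x -> 0 <= log2 x.
Proof. by move=> x_ge1; rewrite log2E divr_ge0 ?ln_ge0 ?ler1n. Qed.

Lemma log2_le_nat (k m : nat) : (0 < k <= 2 ^ m)%N -> log2 k%:R <= m%:R.
Proof.
case/andP=> k_gt0 lek.
rewrite log2E ler_pdivrMr; last by rewrite ln_gt0 // ltr1n.
by rewrite mulr_natl -lnXn // ler_ln ?posrE ?exprn_gt0 ?ltr0n // -natrX ler_nat.
Qed.

Lemma klog2k_le (k n : nat) : (2 ^ n <= k < 2 ^ n.+1)%N ->
  k%:R * log2 k%:R <= (4 * (n * 2 ^ n))%:R :> R.
Proof.
case/andP=> le_k k_lt.
have k_gt0 : (0 < k)%N by apply: leq_trans le_k; rewrite expn_gt0.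
have log_le : log2 k%:R <= n.*2%:R.
  apply: log2_le_nat; rewrite k_gt0.
  case: n le_k k_lt => [|n] _ k_lt; first by rewrite expn0 -ltnS.
  by rewrite (leq_trans (ltnW k_lt)) // leq_exp2l //; lia.
apply: le_trans (_ : k%:R * n.*2%:R <= _); first by rewrite ler_wpM2l // ler0n.
by rewrite -natrM ler_nat; move: k_lt; rewrite expnS; nia.
Qed.

Lemma kunion_self_shattered_klog2k (k d : nat) : (0 < k)%N -> (4 <= d)%N ->
  exists2 Y : seq (point d),
    kunion_self_shattered k Y &
    d%:R * (k%:R * log2 k%:R) <= 64 * (size Y)%:R :> R.
Proof.
move=> k_gt0 d_ge4; have k_bounds := trunc_log_bounds (isT : (1 < 2)%N) k_gt0.
set n := trunc_log 2 k in k_bounds.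
have [Y shY sizeY] := kunion_self_shattered_pow2 n d_ge4; exists Y.
  apply: shatters_sub shY => S; apply: kunion_leq.
  by rewrite expn_gt0; case/andP: k_bounds.
apply: (le_trans (ler_wpM2l _ (klog2k_le k_bounds))); first exact: ler0n.
have d_le : (d <= 8 * (d %/ 4))%N by lia.
by rewrite -!natrM ler_nat; nia.
Qed.

Lemma scaled_klog2k_le (k d e m n : nat) :
  (0 < k)%N -> (e <= 2 * d)%N -> (m <= n)%N ->
  d%:R * (k%:R * log2 k%:R) <= 64 * m%:R :> R ->
  Rle (Rmult (Rmult (Rmult 128^-1 (INR e)) (INR k)) (log2 (INR k))) (INR n).
Proof.
move=> k_gt0 le_e le_m bound_m; apply/RleP.
rewrite !RmultE !INRE -!mulrA ler_pdivrMl ?ltr0n //.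
have klog_ge0 : 0 <= k%:R * log2 k%:R by rewrite mulr_ge0 ?log2_ge0 ?ler1n.
apply: le_trans (_ : (2 * d)%:R * (k%:R * log2 k%:R) <= _).
  by rewrite ler_wpM2r // ler_nat.
have : m%:R <= n%:R :> R by rewrite ler_nat.
by rewrite natrM; lra.
Qed.

Theorem theorem1 :
  exists c : R, Rlt 0 c /\
  forall k d : nat, (0 < k)%N -> (4 <= d)%N ->
  exists P : point d -> Prop,
  exists n mU mI : nat,
    is_vcdim P (halfspace_system P) n /\
    is_vcdim P (kunion k (halfspace_system P)) mU /\
    is_vcdim P (kinter k (halfspace_system P)) mI /\
    Rle (Rmult (Rmult (Rmult c (INR n)) (INR k)) (log2 (INR k))) (INR mU) /\
    Rle (Rmult (Rmult (Rmult c (INR d)) (INR k)) (log2 (INR k))) (INR mU) /\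
    Rle (Rmult (Rmult (Rmult c (INR n)) (INR k)) (log2 (INR k))) (INR mI) /\
    Rle (Rmult (Rmult (Rmult c (INR d)) (INR k)) (log2 (INR k))) (INR mI).
Proof.
exists 128^-1; split; first by apply/RltP; rewrite invr_gt0 ltr0n.
move=> k d k_gt0 d_ge4.
have [Y shU boundY] := kunion_self_shattered_klog2k k_gt0 d_ge4.
pose P (x : point d) : Prop := x \in Y; exists P.
rewrite /kunion_self_shattered -/P in shU.
have shI : shatters P (kinter k (halfspace_system P)) Y.
  by apply: shatters_kinter shU; apply: halfspace_systemC.
have d_gt0 : (0 < d)%N by lia.
have [n vcn n_le] := vcdim_halfspace_exists P d_gt0.
have leY F Z : shatters P F Z -> (size Z <= size Y)%N.
  exact: shatters_size_le.
have [mU vcU /andP[leU _]] := vcdim_exists (@leY _) shU.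
have [mI vcI /andP[leI _]] := vcdim_exists (@leY _) shI.
exists n, mU, mI; do 3 split=> //.
by do !split; apply: scaled_klog2k_le boundY => //; lia.
Qed.
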